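(* For all integers $n\geq 0$ and $k\geq 0$, $$b_{17}\Big(5^{4k}n+\tfrac{2}{3}\big(5^{4k}-1\big)\Big)\equiv 2^k\, b_{17}(n)\pmod{17},$$ and for every $r\in\{0,1,2,4\}$ and all $n,k\geq 0$, $$b_{17}\Big(5^{4k+4}n+\tfrac{1}{3}\big(5^{4k+3}(3r+1)-2\big)\Big)\equiv 0\pmod{17}.$$
   Context: For an integer $l\geq 2$, a partition of a positive integer $n$ is $l$-regular if none of its parts is divisible by $l$. $b_l(n)$ denotes the number of $l$-regular partitions of $n$, with $b_l(0)=1$; equivalently $\sum_{n\ge0} b_l(n)q^n=\prod_{i\ge1}(1-q^{li})/(1-q^i)$. *)

(* Defs.v *)
From mathcomp Require Import all_boot.
Set Implicit Arguments. Unset Strict Implicit. Unset Printing Implicit Defensive.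

Definition is_partition (n : nat) (s : seq nat) : bool :=
  [&& sorted geq s, all (fun x => 0 < x) s & sumn s == n].

Definition is_regular (l : nat) (s : seq nat) : bool :=
  all (fun x => ~~ (l %| x)) s.

(* All sequences of length <= len with entries in 1..m (a finite superset of
   the partitions of any n <= min(len, m)). *)
Fixpoint seqs_upto (len m : nat) : seq (seq nat) :=
  match len with
  | 0 => [:: [::]]
  | len'.+1 => [::] :: [seq x :: t | x <- iota 1 m, t <- seqs_upto len' m]
  end.

Definition b (l n : nat) : nat :=
  count (fun s => is_partition n s && is_regular l s) (undup (seqs_upto n n)).

(* Main.v *)
Require Import Defs.
From HB Require Import structures.
From mathcomp Require Import all_boot all_order all_algebra all_field.
From mathcomp Require Import boolp ring zify.
Set Implicit Arguments. Unset Strict Implicit. Unset Printing Implicit Defensive.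
Import Order.TTheory GRing.Theory Num.Theory.
Local Open Scope ring_scope.

(** Write E for the product of all 1 - q^i and U_c for the operator sending
    sum f(n) q^n to sum f(5 n + c) q^n.  Modulo 17 the generating function of
    b_17 is E(q^17) / E(q) = E^16, so everything follows from
      U_1 U_3 U_1 E^16 = 2 q^3 E(q^5)^16  (mod 17):
    the exponents n with n <> 3 mod 5 vanish after three steps, and those with
    n = 3 mod 5 reproduce the original series.
    By the pentagonal number theorem E has the 5-dissection A - y + g with
    y = q E(q^25), and A g = - y^2 by a sign-reversing reflection on pairs of
    pentagonal indices.  Taking the norm over the fifth roots of unity gives
    A^5 - 11 y^5 + g^5 = E(q^5)^6 / E(q^25), hence a quintic equation for E over
    the series in q^5, and U of y^j E^k is computed by Newton's recursion. *)

(** * Formal power series *)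

(** The wrapper attaches the Cauchy product to series rather than to functions [nat -> R]. Equality
    is Leibniz equality, by functional extensionality. *)
Record fps (R : Type) := Fps { fcoef :> nat -> R }.

HB.instance Definition _ (R : Type) := gen_eqMixin (fps R).
HB.instance Definition _ (R : Type) := gen_choiceMixin (fps R).

Lemma fpsP (R : Type) (f g : fps R) : (forall n, f n = g n) -> f = g.
Proof. by case: f g => f [g] /= /funext ->. Qed.

Section FpsRing.
Variable R : comNzRingType.
Implicit Types (f g h : fps R) (n : nat).

(** Coefficient [n] of a product depends only on coefficients up to [n], so the ring axioms are
    inherited from polynomials through these truncations. *)
Definition trunc n f : {poly R} := \poly_(i < n.+1) f i.

Definition fps_add f g := Fps (fun n => f n + g n).
Definition fps_opp f := Fps (fun n => - f n).
Definition fps_zero : fps R := Fps (fun => 0).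
Definition fps_one : fps R := Fps (fun n => (n == 0%N)%:R).
Definition fps_mul f g := Fps (fun n => \sum_(i < n.+1) f i * g (n - i)%N).

Lemma coef_trunc m n f : (n <= m)%N -> (trunc m f)`_n = f n.
Proof. by move=> le_nm; rewrite coef_poly ltnS le_nm. Qed.

Lemma fps_mul_trunc m n f g :
  (n <= m)%N -> fps_mul f g n = (trunc m f * trunc m g)`_n.
Proof.
move=> le_nm; rewrite coefM; apply: eq_bigr => i _.
have lei : (i <= n)%N by rewrite -ltnS.
by rewrite !coef_trunc // (leq_trans _ le_nm) // leq_subr.
Qed.

Lemma coefM_congr n (p p' q q' : {poly R}) :
  (forall i, (i <= n)%N -> p`_i = p'`_i) ->
  (forall i, (i <= n)%N -> q`_i = q'`_i) -> (p * q)`_n = (p' * q')`_n.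
Proof.
move=> eqp eqq; rewrite !coefM; apply: eq_bigr => i _.
by rewrite eqp ?eqq ?leq_subr // -ltnS.
Qed.

Fact fps_addA : associative fps_add.
Proof. by move=> f g h; apply: fpsP => n /=; rewrite addrA. Qed.
Fact fps_addC : commutative fps_add.
Proof. by move=> f g; apply: fpsP => n /=; rewrite addrC. Qed.
Fact fps_add0 : left_id fps_zero fps_add.
Proof. by move=> f; apply: fpsP => n /=; rewrite add0r. Qed.
Fact fps_addN : left_inverse fps_zero fps_opp fps_add.
Proof. by move=> f; apply: fpsP => n /=; rewrite addNr. Qed.

HB.instance Definition _ :=
  GRing.isZmodule.Build (fps R) fps_addA fps_addC fps_add0 fps_addN.

Fact fps_mulC : commutative fps_mul.
Proof. by move=> f g; apply: fpsP => n; rewrite !(fps_mul_trunc _ _ (leqnn n)) mulrC. Qed.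
Fact fps_mulA : associative fps_mul.
Proof.
move=> f g h; apply: fpsP => n; rewrite !(fps_mul_trunc _ _ (leqnn n)).
transitivity ((trunc n f * (trunc n g * trunc n h))`_n).
  apply: coefM_congr => // i lein.
  by rewrite coef_trunc // (fps_mul_trunc _ _ lein).
rewrite mulrA; apply: coefM_congr => // i lein.
by rewrite coef_trunc // (fps_mul_trunc _ _ lein).
Qed.
Fact fps_mul1 : left_id fps_one fps_mul.
Proof.
move=> f; apply: fpsP => n /=; rewrite big_ord_recl subn0 mul1r.
by rewrite big1 ?addr0 // => i _; rewrite mul0r.
Qed.
Fact fps_mulDl : left_distributive fps_mul fps_add.
Proof.
move=> f g h; apply: fpsP => n /=; rewrite -big_split.
by apply: eq_bigr => i _; rewrite mulrDl.
Qed.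
Fact fps_one_neq0 : fps_one != fps_zero.
Proof.
apply/eqP => /(congr1 (fun f : fps R => f 0%N)) /= /eqP.
by rewrite oner_eq0.
Qed.

HB.instance Definition _ :=
  GRing.Zmodule_isComNzRing.Build (fps R) fps_mulA fps_mulC fps_mul1 fps_mulDl
    fps_one_neq0.

Lemma fps1E n : (1 : fps R) n = (n == 0%N)%:R. Proof. by []. Qed.
Lemma fpsDE f g n : (f + g) n = f n + g n. Proof. by []. Qed.
Lemma fpsNE f n : (- f) n = - f n. Proof. by []. Qed.
Lemma fpsBE f g n : (f - g) n = f n - g n. Proof. by []. Qed.
Lemma fpsME f g n : (f * g) n = \sum_(i < n.+1) f i * g (n - i)%N.
Proof. by []. Qed.
Lemma fps_sumE I (r : seq I) (P : pred I) (F : I -> fps R) n :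
  (\sum_(i <- r | P i) F i) n = \sum_(i <- r | P i) F i n.
Proof. by elim/big_rec2: _ => // i x y _ <-. Qed.

Lemma fpsM0 f g : (f * g) 0%N = f 0%N * g 0%N.
Proof. by rewrite fpsME big_ord_recl big_ord0 addr0. Qed.

Definition fX : fps R := Fps (fun n => (n == 1%N)%:R).

Lemma fXnE k n : (fX ^+ k) n = (n == k)%:R.
Proof.
elim: k n => [|k IHk] n; first by rewrite expr0.
rewrite exprS fpsME; case: n => [|n].
  by rewrite big_ord_recl big_ord0 mul0r addr0.
rewrite 2!big_ord_recl big1 => [|i _]; last by rewrite mul0r.
by rewrite mul0r mul1r add0r addr0 subn1 IHk eqSS.
Qed.

Lemma fXnM k f n : (fX ^+ k * f) n = if (n < k)%N then 0 else f (n - k)%N.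
Proof.
rewrite fpsME; case: ltnP => [lt_nk | le_kn].
  apply: big1 => i _; rewrite fXnE ltn_eqF ?mul0r //.
  by apply: leq_trans lt_nk; rewrite ltnS -ltnS.
have ltk : (k < n.+1)%N by [].
rewrite (bigD1 (Ordinal ltk)) //= fXnE eqxx mul1r big1 ?addr0 // => i.
by rewrite -val_eqE /= fXnE => /negPf->; rewrite mul0r.
Qed.

Lemma fXM f n : (fX * f) n = if n is n'.+1 then f n' else 0.
Proof. by rewrite -[fX]expr1 fXnM; case: n => //= n; rewrite subn1. Qed.

Lemma fX_inj : injective (fun f => fX * f).
Proof.
move=> f g eqfg; apply: fpsP => n.
by move: (congr1 (fun h : fps R => h n.+1) eqfg); rewrite !fXM.
Qed.

(** Congruence modulo q^(n+1): the tool for passing from finite products to infinite ones. *)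
Definition eqt n f g := forall i, (i <= n)%N -> f i = g i.

Lemma eqtM n f f' g g' : eqt n f f' -> eqt n g g' -> eqt n (f * g) (f' * g').
Proof.
move=> eqf eqg i lein; rewrite !fpsME; apply: eq_bigr => j _.
have leji : (j <= i)%N by rewrite -ltnS.
by rewrite eqf ?eqg // (leq_trans _ lein) ?leq_subr.
Qed.

Lemma eqt_fps f g : (forall n, eqt n f g) -> f = g.
Proof. by move=> eqfg; apply: fpsP => n; apply: (eqfg n). Qed.

(** With constant term 1, the coefficients of the cofactor are determined one after the other. This
    replaces division of series throughout. *)
Lemma fps_unit_lreg f : f 0%N = 1 -> GRing.lreg f.
Proof.
move=> f0 g h eqfgh; apply: eqt_fps => n; elim: n => [|n IHn] i lein.
  move: lein; rewrite leqn0 => /eqP ->.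
  by move: (congr1 (fun h : fps R => h 0%N) eqfgh); rewrite !fpsM0 f0 !mul1r.
case: (ltngtP i n.+1) lein => // [lti _ | -> _]; first exact: IHn.
move: (congr1 (fun h : fps R => h n.+1) eqfgh).
rewrite !fpsME [X in X = _]big_ord_recl [X in _ = X]big_ord_recl.
rewrite f0 !mul1r subn0 => eqS.
apply: (addIr (\sum_(i0 < n.+1)
   f (lift ord0 i0) * g (n.+1 - lift ord0 i0)%N)).
rewrite eqS; congr (_ + _); apply: eq_bigr => j _.
by rewrite IHn // lift0 subSS leq_subr.
Qed.

Lemma fpsX0 f n : f 0%N = 1 -> (f ^+ n) 0%N = 1.
Proof. by move=> f0; elim: n => // n IHn; rewrite exprS fpsM0 f0 IHn mulr1. Qed.

Section Dilate.
Variable d : nat.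

(** [V d f] is f(q^d), and [U d] is its left inverse, linear over series in q^d ([UV_mul]). *)
Definition V f := Fps (fun n => if (d %| n)%N then f (n %/ d)%N else 0).
Definition U f := Fps (fun n => f (d * n)%N).

Fact U_zmod : zmod_morphism U.
Proof. by move=> f g; apply: fpsP. Qed.
HB.instance Definition _ := GRing.isZmodMorphism.Build _ _ U U_zmod.

Hypothesis d_gt0 : (0 < d)%N.

Lemma VE f n : V f (d * n)%N = f n.
Proof. by rewrite /= dvdn_mulr // mulKn. Qed.

Lemma V_inj : injective V.
Proof. by move=> f g eqV; apply: fpsP => n; rewrite -[LHS]VE eqV VE. Qed.

Lemma UV f : U (V f) = f.
Proof. by apply: fpsP => n; rewrite -[RHS]VE. Qed.

Lemma UV_mul f g : U (V f * g) = f * U g.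
Proof.
apply: fpsP => n; rewrite [LHS]fpsME fpsME (bigID (fun i : 'I__ => d %| i)%N) /=.
rewrite [X in _ + X]big1 ?addr0; last by move=> i /negPf->; rewrite mul0r.
(* Only the indices i = d j contribute, since [V f] vanishes at the others. *)
rewrite (reindex_onto (fun j : 'I_n.+1 => inord (d * j))
                      (fun i => inord (i %/ d))) /=; last first.
  move=> i dvi; apply: val_inj.
  have lti : (i %/ d < n.+1)%N by rewrite ltnS -[X in (_ <= X)%N](mulKn n d_gt0) leq_div2r // -ltnS.
  by rewrite /= !inordK // mulnC divnK.
have vE (j : 'I_n.+1) : (inord (d * j) : 'I_(d * n).+1) = (d * j)%N :> nat.
  by rewrite inordK // ltnS leq_mul2l -ltnS ltn_ord orbT.
apply: eq_big => [j | j _]; first by rewrite vE dvdn_mulr // mulKn // inord_val eqxx.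
by rewrite vE dvdn_mulr // mulKn // -mulnBr.
Qed.

Fact V_zmod : zmod_morphism V.
Proof. by move=> f g; apply: fpsP => n /=; case: ifP => // _; rewrite subr0. Qed.
HB.instance Definition _ := GRing.isZmodMorphism.Build _ _ V V_zmod.

Fact V_monoid : monoid_morphism V.
Proof.
split=> [|f g]; apply: fpsP => n.
  rewrite [LHS]/= !fps1E; case: ifP => [dvn | ndvn].
    by rewrite -[in RHS](divnK dvn) muln_eq0 (gtn_eqF d_gt0) orbF.
  by case: n ndvn => [|n] //; rewrite dvdn0.
case dvn: (d %| n)%N.
  by rewrite -(divnK dvn) mulnC VE -[RHS]/(U (V f * V g) _) UV_mul UV.
rewrite [LHS]/= dvn fpsME big1 // => i _ /=.
case dvi: (d %| i)%N; rewrite ?mul0r //.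
by rewrite dvdn_subl ?dvn ?mulr0 // -ltnS.
Qed.

Lemma VX : V fX = fX ^+ d.
Proof.
apply: fpsP => n; rewrite fXnE /=; case: ifP => [dvn | ndvn].
  by rewrite eq_sym eqn_div // mul1n eq_sym.
by case: eqP ndvn => // ->; rewrite dvdnn.
Qed.

Lemma V_coef0 f : V f 0%N = f 0%N. Proof. by rewrite /= dvdn0 div0n. Qed.

Lemma UX_V c f : ~~ (d %| c)%N -> U (V f * fX ^+ c) = 0.
Proof.
move=> ndc; rewrite UV_mul; apply: fpsP => n.
rewrite fpsME big1 // => i _; rewrite /= fXnE.
by case: eqP => [ec |]; rewrite ?mulr0 // -ec dvdn_mulr in ndc *.
Qed.

End Dilate.

HB.instance Definition _ d :=
  GRing.isMonoidMorphism.Build _ _ (V d.+1) (V_monoid (ltn0Sn d)).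

Lemma VV d1 d2 f : (0 < d1)%N -> (0 < d2)%N -> V d1 (V d2 f) = V (d1 * d2) f.
Proof.
move=> d1_gt0 d2_gt0; apply: fpsP => n /=.
case d1n: (d1 %| n)%N; first by rewrite dvdn_divRL // divnMA [(d2 * _)%N]mulnC.
by case: ifP => // /(dvdn_trans (dvdn_mulr _ (dvdnn d1))); rewrite d1n.
Qed.

End FpsRing.

(** * Euler's product and the pentagonal number theorem *)

Section Euler.
Variable R : comNzRingType.
Local Notation q := (fX R).

Definition euler_part N : fps R := \prod_(i < N) (1 - q ^+ i.+1).
(** The infinite product, read off diagonally: factors 1 - q^m with m > n leave coefficient [n]
    unchanged. *)
Definition euler : fps R := Fps (fun n => euler_part n n).

Lemma euler_partS N : euler_part N.+1 = euler_part N * (1 - q ^+ N.+1).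
Proof. by rewrite /euler_part big_ord_recr. Qed.

Lemma euler_trunc n N : (n <= N)%N -> eqt n euler (euler_part N).
Proof.
move=> lenN i lein; have: (i <= N)%N := leq_trans lein lenN.
elim: N {n lenN lein} => [|N IHN]; first by rewrite leqn0 => /eqP ->.
case: (ltngtP i N.+1) => // [ltiN _ | -> //].
by rewrite euler_partS mulrC mulrBl mul1r fpsBE fXnM ltiN subr0 IHN.
Qed.

Lemma euler0 : euler 0%N = 1.
Proof. by rewrite /= /euler_part big_ord0. Qed.

(* Shanks' finite form of the pentagonal number theorem: the terms with s > 0
   have order > n, and the sum telescopes in n. *)
Definition shanks_term n s : fps R :=
  (-1) ^+ s * (\prod_(s <= i < n) (1 - q ^+ i.+1))
           * q ^+ (s * n + 'C(s.+1, 2)).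

Lemma shanks n :
  \sum_(s < n.+1) shanks_term n s
  = 1 + \sum_(1 <= s < n.+1)
          (-1) ^+ s * (q ^+ (s ^ 2 + 'C(s, 2)) + q ^+ (s ^ 2 + 'C(s.+1, 2))).
Proof.
elim: n => [|n IHn].
  by rewrite big_ord1 big_geq // /shanks_term big_geq // expr0 !mul1r addr0.
rewrite big_nat_recr //= addrA -IHn big_ord_recr /=.
rewrite -(big_mkord xpredT (shanks_term n.+1)) -(big_mkord xpredT (shanks_term n)).
(* Passing from [n] to [n.+1] changes the term of index [s.+1] by [h s - h s.+1], so the sum
   telescopes. The boundary value [- h n] and the new last term are the two new pentagonal terms. *)
pose h s : fps R := (-1) ^+ s * (\prod_(s <= i < n) (1 - q ^+ i.+1))
           * q ^+ (s * n + 'C(s.+1, 2) + n.+1 + s).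
have b1 s : 'C(s.+1, 2) = ('C(s, 2) + s)%N by rewrite binS bin1.
have b2 s : 'C(s.+2, 2) = ('C(s, 2) + s + s.+1)%N by rewrite binS bin1 b1.
have step s : (s < n)%N -> shanks_term n.+1 s.+1 = shanks_term n s.+1 + h s - h s.+1.
  move=> ltsn; rewrite /h /shanks_term.
  rewrite (@big_nat_recr _ _ _ n s.+1) //= (@big_ltn _ _ _ s n) //.
  set P := \prod_(_ <= i < _) _; rewrite b2 b1 exprS.
  have -> : (s.+1 * n.+1 + ('C(s, 2) + s + s.+1) = s * n + 'C(s, 2) + s + s + n + s + 2)%N by rewrite mulnS mulSn; lia.
  have -> : (s.+1 * n + ('C(s, 2) + s + s.+1) = s * n + 'C(s, 2) + s + s + n + 1)%N by rewrite mulSn; lia.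
  have -> : (s * n + ('C(s, 2) + s) + n.+1 + s = s * n + 'C(s, 2) + s + s + n + 1)%N by lia.
  by rewrite !exprD !exprS; ring.
have sums m : (m <= n)%N -> \sum_(0 <= s < m.+1) shanks_term n.+1 s
            = \sum_(0 <= s < m.+1) shanks_term n s - h m.
  elim: m => [|m IHm] lemn.
    rewrite !big_nat1 /h /shanks_term !mul0n (@big_nat_recr _ _ _ n 0) //= !addn0 !add0n.
    by rewrite !expr0 !mul1r mulr1 mulrBr mulr1.
  by rewrite big_nat_recr // IHm ?(ltnW lemn) // step // [in RHS]big_nat_recr //=; ring.
rewrite (sums n) // -addrA; congr (_ + _).
rewrite /h /shanks_term !big_geq // !mulr1 mulrDr; congr (_ + _).
rewrite exprS mulN1r mulNr; congr (- (_ * _ ^+ _)).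
by rewrite b1 -mulnn !mulnS !mulSn; lia.
Qed.

End Euler.

(* The generalized pentagonal numbers; [24 * pent s + 1 = (6 s + 1) ^ 2]. *)
Definition pent (s : int) : nat := `|(s * (3 * s + 1))%R|%N./2.
Definition sgnz (s : int) : int := (-1) ^+ `|s|%N.
Definition zrange (M : nat) : seq int := [seq i%:Z - M%:Z | i <- iota 0 (M + M).+1].
Arguments zrange : simpl never.

(** The product is even and nonnegative, so neither the absolute value nor the halving in [pent]
    loses anything. *)
Lemma pentE s : (pent s)%:Z * 2 = s * (3 * s + 1).
Proof.
have ev : (2 %| `|(s * (3 * s + 1))%R|)%N.
  by case: s => n; rewrite dvdn2 abszM oddM; lia.
have ge0 : 0 <= s * (3 * s + 1) by nia.
rewrite /pent -divn2; lia.
Qed.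

Lemma mem_zrange M s : (s \in zrange M) = (`|s| <= M)%N.
Proof.
apply/mapP/idP => [[i] | les].
  by rewrite mem_iota => lei ->; lia.
exists `|(s + M%:Z)%R|%N; first by rewrite mem_iota; lia.
by lia.
Qed.

Lemma zrange_uniq M : uniq (zrange M).
Proof. by rewrite map_inj_uniq ?iota_uniq // => i j; lia. Qed.

(** The difference of two values factors as (t - s) (3 (t + s) + 1), and the second factor is
    nonzero modulo 3. *)
Lemma pent_inj : injective pent.
Proof.
move=> s t eqst; have := pentE s; rewrite eqst pentE => /eqP.
rewrite -subr_eq0 (_ : _ - _ = (t - s) * (3 * (t + s) + 1)); last by ring.
rewrite mulf_eq0 => /orP[|] /eqP; lia.
Qed.

Lemma pent_bound s : (`|s| <= pent s)%N.
Proof. have := pentE s; nia. Qed.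

Lemma zrange_sum (F : int -> int) M :
  \sum_(s <- zrange M) F s = F 0 + \sum_(1 <= s < M.+1) (F s%:Z + F (- s%:Z)).
Proof.
elim: M => [|M IHM]; first by rewrite big_geq // big_cons big_nil.
rewrite big_nat_recr //= addrA -IHM -addrC.
have perm : perm_eq (zrange M.+1) [:: M.+1%:Z, - M.+1%:Z & zrange M].
  apply: uniq_perm; first exact: zrange_uniq.
    by rewrite 2!cons_uniq zrange_uniq in_cons !mem_zrange; lia.
  by move=> s; rewrite mem_zrange 2!in_cons mem_zrange; lia.
by rewrite (perm_big _ perm) -addrA [LHS]big_cons; congr (_ + _); apply: big_cons.
Qed.

Lemma bin2D s : ('C(s, 2) * 2 + s = s ^ 2)%N.
Proof. by elim: s => // s; rewrite binS bin1 -!mulnn; lia. Qed.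

Lemma pent_pos (s : nat) : pent s = (s ^ 2 + 'C(s.+1, 2))%N.
Proof. have := pentE s; rewrite binS bin1; have := bin2D s; rewrite -mulnn; nia. Qed.

Lemma pent_neg (s : nat) : pent (- s%:Z) = (s ^ 2 + 'C(s, 2))%N.
Proof. have := pentE (- s%:Z); have := bin2D s; rewrite -mulnn; nia. Qed.

Lemma euler_pent (n M : nat) : (n <= M)%N ->
  euler int n = \sum_(s <- zrange M) sgnz s * (n == pent s)%:R.
Proof.
move=> lenM; transitivity ((\sum_(s < M.+1) shanks_term int M s) n).
  rewrite big_ord_recl fpsDE [X in _ + X]fps_sumE big1 ?addr0; last first.
    move=> s _; rewrite /shanks_term mulrC fXnM ifT // lift0 binS bin1; nia.
  rewrite /shanks_term big_mkord expr0 mul1r mulr1.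
  exact: (euler_trunc int lenM (leqnn n)).
rewrite shanks zrange_sum fpsDE fps_sumE fps1E; congr (_ + _).
  by rewrite /sgnz /= expr0 mul1r.
apply: eq_bigr => s _; rewrite pent_pos pent_neg /sgnz abszN absz_nat.
rewrite -signr_odd -[in RHS]signr_odd; case: (odd s).
  by rewrite !expr1 !mulN1r fpsNE fpsDE !fXnE opprD addrC.
by rewrite !expr0 !mul1r fpsDE !fXnE addrC.
Qed.

Lemma euler_pentE s : euler int (pent s) = sgnz s.
Proof.
rewrite (euler_pent (leqnn _)) (bigD1_seq s) ?zrange_uniq ?mem_zrange ?pent_bound //=.
rewrite eqxx mulr1 big1 ?addr0 // => t nts.
by rewrite (inj_eq pent_inj) eq_sym (negPf nts) mulr0.
Qed.

Lemma euler_npent n : (forall s, n <> pent s) -> euler int n = 0.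
Proof.
move=> np; rewrite (euler_pent (leqnn _)) big1 // => s _.
by case: eqP => [/np | ]; rewrite ?mulr0.
Qed.

(** * The 5-dissection of Euler's product *)

Lemma sgnzD s t : sgnz (s + t) = sgnz s * sgnz t.
Proof.
rewrite /sgnz -exprD -signr_odd -[RHS]signr_odd.
by congr (_ ^+ nat_of_bool _); lia.
Qed.

Lemma sgnz_odd s t : ~~ (2 %| s - t)%Z -> sgnz s = - sgnz t.
Proof.
move=> odd_st; rewrite /sgnz -signr_odd -[X in _ = - X]signr_odd -signrN.
by congr (_ ^+ nat_of_bool _); lia.
Qed.

(* With [t = 2 s + 1 + 5 k], the sum [pent s + pent t] is, for fixed [k], a
   quadratic polynomial in [s] symmetric about [(-1 - 4 k) / 2], and the
   reflection reverses the sign. *)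
Lemma lattice_sum0 N M : (N <= M)%N ->
  \sum_(s <- zrange M) \sum_(t <- zrange M)
     sgnz s * sgnz t * (N == (pent s + pent t)%N)%:R
       * (5%:Z %| t - 2 * s - 1)%Z%:R = 0 :> int.
Proof.
move=> leNM; pose F (x : int * int) := sgnz x.1 * sgnz x.2.
pose D (x : int * int) :=
  (N == pent x.1 + pent x.2)%N && (5%:Z %| x.2 - 2 * x.1 - 1)%Z.
pose L := [seq x <- [seq (s, t) | s <- zrange M, t <- zrange M] | D x].
transitivity (\sum_(x <- L) F x).
  rewrite [RHS]big_filter [RHS]big_mkcond big_allpairs_dep /=.
  apply: eq_bigr => s _; apply: eq_bigr => t _; rewrite /D /F /=.
  by do 2![case: eqP => _ || case: (_ %| _)%Z]; rewrite ?mulr1 ?mulr0 ?mul0r.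
pose phi (x : int * int) : int * int :=
  let k := ((x.2 - 2 * x.1 - 1) %/ 5)%Z in
  (- 1 - 4 * k - x.1, x.2 + 2 * (- 1 - 4 * k - 2 * x.1)).
have phiE s t k : t = 2 * s + 1 + 5 * k ->
    phi (s, t) = (- 1 - 4 * k - s, 2 * (- 1 - 4 * k - s) + 1 + 5 * k).
  by move=> -> ; rewrite /phi /=; congr (_, _); lia.
have DP x : D x -> {k | x.2 = 2 * x.1 + 1 + 5 * k & N = (pent x.1 + pent x.2)%N}.
  case/andP => /eqP eN dv; exists ((x.2 - 2 * x.1 - 1) %/ 5)%Z => //; lia.
have Dphi x : D x -> D (phi x).
  case: x => s t /DP [k /= et eN]; rewrite (phiE _ _ _ et) /D /=.
  apply/andP; split; last by lia.
  have eqp : s * (3 * s + 1) + t * (3 * t + 1)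
    = (- 1 - 4 * k - s) * (3 * (- 1 - 4 * k - s) + 1)
      + (2 * (- 1 - 4 * k - s) + 1 + 5 * k)
        * (3 * (2 * (- 1 - 4 * k - s) + 1 + 5 * k) + 1).
    by rewrite et; ring.
  by rewrite -!pentE in eqp; lia.
have phiK x : D x -> phi (phi x) = x.
  case: x => s t /DP [k /= et eN]; rewrite (phiE _ _ _ et) (phiE _ _ k) //.
  by rewrite et; congr (_, _); lia.
have Fphi x : D x -> F (phi x) = - F x.
  case: x => s t /DP [k /= et eN]; rewrite (phiE _ _ _ et) /F /= -!sgnzD.
  (* The index sums of a pair and its reflection differ by 3 (2 s + 1 + 4 k), an odd number. *)
  by rewrite (sgnz_odd (t := s + t)) //; lia.
have LE x : (x \in L) = D x.
  rewrite mem_filter; case Dx: (D x) => //; rewrite andTb; case: x Dx => s t /andP [/eqP eN _].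
  rewrite /= in eN; apply/allpairsPdep; exists s, t; rewrite !mem_zrange.
  by split=> //; [have := pent_bound s | have := pent_bound t]; lia.
have uL : uniq L.
  rewrite filter_uniq // allpairs_uniq ?zrange_uniq //.
  by move=> [? ?] [? ?] _ _ [-> ->].
have permL : perm_eq L (map phi L).
  apply: uniq_perm => //.
    rewrite map_inj_in_uniq // => x y; rewrite !LE => Dx Dy eqphi.
    by rewrite -(phiK _ Dx) eqphi phiK.
  move=> x; rewrite LE; apply/idP/mapP => [Dx | [y]].
    by exists (phi x); rewrite ?LE ?phiK // Dphi.
  by rewrite LE => Dy ->; apply: Dphi.
have : \sum_(x <- L) F x = - \sum_(x <- L) F x.
  rewrite {1}(perm_big _ permL) big_map -sumrN big_seq [RHS]big_seq.
  by apply: eq_bigr => x; rewrite LE; apply: Fphi.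
lia.
Qed.

Section Parts.
Variable R : comNzRingType.
Implicit Types f : fps R.

Definition part5 c f := Fps (fun n => if (n %% 5 == c)%N then f n else 0).
Definition Uc c f := Fps (fun n => f (5 * n + c)%N).

Lemma part5E c f : (c < 5)%N -> part5 c f = V 5 (Uc c f) * fX R ^+ c.
Proof.
move=> ltc5; apply: fpsP => n; rewrite mulrC fXnM [LHS]/=.
case: ltnP => [ltnc | lecn].
  by rewrite modn_small ?ltn_eqF // (ltn_trans ltnc).
rewrite [RHS]/= (_ : (5 %| n - c)%N = (n %% 5 == c)%N); last by lia.
by case: eqP => // eqc; congr (f _); lia.
Qed.

End Parts.

(** The booleans test [pent s] for the residues 0, 1 and 2 modulo 5. Exactly one holds in each case,
    so the residues 3 and 4 never occur, and residue 1 forces s = 4 modulo 5. *)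
Variant pent_mod5_spec (s : int) : bool -> bool -> bool -> Prop :=
  | PentMod0 of (s %% 5)%Z = 0 : pent_mod5_spec s true false false
  | PentMod1 of (s %% 5)%Z = 1 : pent_mod5_spec s false false true
  | PentMod2 of (s %% 5)%Z = 2 : pent_mod5_spec s false false true
  | PentMod3 of (s %% 5)%Z = 3 : pent_mod5_spec s true false false
  | PentMod4 of (s %% 5)%Z = 4 : pent_mod5_spec s false true false.

Lemma pent_mod5P s : pent_mod5_spec s
  (pent s %% 5 == 0)%N (pent s %% 5 == 1)%N (pent s %% 5 == 2)%N.
Proof.
pose u := (s %/ 5)%Z; pose r := (s %% 5)%Z.
have es : s = 5 * u + r by rewrite /u /r; lia.
have : r = 0 \/ r = 1 \/ r = 2 \/ r = 3 \/ r = 4 by rewrite /r; lia.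
have eq2 : (pent s)%:Z * 2 = 5 * (u * (15 * u + 6 * r + 1)) + r * (3 * r + 1).
  by rewrite pentE es; ring.
move: eq2; set w := u * _; rewrite /r => eq2.
case=> [|[|[|[|]]]] er; rewrite er in eq2.
- have [-> -> ->] : [/\ (pent s %% 5 == 0)%N = true, (pent s %% 5 == 1)%N = false & (pent s %% 5 == 2)%N = false] by split; lia.
  by constructor.
- have [-> -> ->] : [/\ (pent s %% 5 == 0)%N = false, (pent s %% 5 == 1)%N = false & (pent s %% 5 == 2)%N = true] by split; lia.
  by constructor.
- have [-> -> ->] : [/\ (pent s %% 5 == 0)%N = false, (pent s %% 5 == 1)%N = false & (pent s %% 5 == 2)%N = true] by split; lia.
  by constructor.
- have [-> -> ->] : [/\ (pent s %% 5 == 0)%N = true, (pent s %% 5 == 1)%N = false & (pent s %% 5 == 2)%N = false] by split; lia.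
  by constructor.
- have [-> -> ->] : [/\ (pent s %% 5 == 0)%N = false, (pent s %% 5 == 1)%N = true & (pent s %% 5 == 2)%N = false] by split; lia.
  by constructor.
Qed.

Local Notation E := (euler int).

Lemma euler_part5_sum : E = part5 0 E + part5 1 E + part5 2 E.
Proof.
apply: fpsP => n; rewrite !fpsDE /=.
case: (pselect (exists s, n = pent s)) => [[s ->] | np].
  by case: (pent_mod5P s); rewrite ?addr0 ?add0r.
have -> : euler_part int n n = E n by [].
rewrite euler_npent; first by rewrite !if_same !addr0.
by move=> s ns; apply: np; exists s.
Qed.

(** The indices concerned are s = - 5 v - 1, for which pent s = 25 pent v + 1. The sign flips
    because s - v is odd. *)
Lemma euler_Uc1 : Uc 1 E = - V 5 E.
Proof.
apply: fpsP => n; rewrite fpsNE.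
have -> : Uc 1 E n = E (5 * n + 1)%N by [].
have -> : V 5 E n = if (5 %| n)%N then E (n %/ 5)%N else 0 by [].
case: (pselect (exists s, (5 * n + 1)%N = pent s)) => [[s es] | np].
  have s4 : (s %% 5)%Z = 4.
    have : (pent s %% 5 == 1)%N by lia.
    by case: (pent_mod5P s).
  pose v := - ((s + 1) %/ 5)%Z.
  have sE : s = - (5 * v) - 1 by rewrite /v; lia.
  have eqp : (pent s)%:Z = 25 * (pent v)%:Z + 1.
    suff : (pent s)%:Z * 2 = 25 * ((pent v)%:Z * 2) + 2 by lia.
    by rewrite !pentE sE; ring.
  rewrite es euler_pentE ifT; last by lia.
  rewrite (_ : (n %/ 5)%N = pent v) ?euler_pentE; last by lia.
  by apply: sgnz_odd; lia.
rewrite euler_npent; last by move=> s es; apply: np; exists s.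
case: ifP => [dvn | _]; last by rewrite oppr0.
rewrite euler_npent ?oppr0 // => v ev; apply: np; exists (- (5 * v) - 1).
suff : 25 * ((pent v)%:Z * 2) + 2 = (pent (- (5 * v) - 1))%:Z * 2 by lia.
by rewrite !pentE; ring.
Qed.

(** Twice the relation is a sum over pairs of pentagonal indices with weight [W]. On residues modulo
    5, [W] is the sum of the indicators of t = 2 s + 1 and s = 2 t + 1, and each of the two sums
    vanishes by [lattice_sum0]. *)
Lemma euler_part5_rel : part5 0 E * part5 2 E = - part5 1 E ^+ 2.
Proof.
pose W i j : int := ((i %% 5 == 0)%N && (j %% 5 == 2)%N)%:R
  + ((i %% 5 == 2)%N && (j %% 5 == 0)%N)%:R
  + ((i %% 5 == 1)%N && (j %% 5 == 1)%N)%:R * 2.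
have WE s t : W (pent s) (pent t)
    = (5%:Z %| t - 2 * s - 1)%Z%:R + (5%:Z %| s - 2 * t - 1)%Z%:R.
  by rewrite /W; case: (pent_mod5P s) => es; case: (pent_mod5P t) => et;
    case d1: (_ %| t - _ - _)%Z; case d2: (_ %| s - _ - _)%Z; try (by []); try (exfalso; lia).
suff : part5 0 E * part5 2 E *+ 2 + part5 1 E ^+ 2 *+ 2 = 0.
  move: (part5 0 E * _) (part5 1 E ^+ 2) => f g eq0; apply: fpsP => n.
  have : (f *+ 2 + g *+ 2) n = 0 by rewrite eq0.
  by rewrite !mulr2n !fpsDE fpsNE; lia.
apply: fpsP => N.
transitivity (\sum_(i < N.+1) W i (N - i)%N * (E i * E (N - i)%N)).
  rewrite (_ : _ *+ 2 + _ = part5 0 E * part5 2 E + part5 2 E * part5 0 E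
    + (part5 1 E * part5 1 E + part5 1 E * part5 1 E)); last by ring.
  rewrite !fpsDE !fpsME -!big_split; apply: eq_bigr => i _ /=.
  by rewrite /W; do 6!case: eqP => _ //=; ring.
have eE i : (i <= N)%N -> E i = \sum_(s <- zrange N) sgnz s * (i == pent s)%:R.
  by move=> leiN; rewrite (euler_pent leiN).
transitivity (\sum_(s <- zrange N) \sum_(t <- zrange N)
   sgnz s * sgnz t * (N == pent s + pent t)%N%:R * W (pent s) (pent t)).
  under eq_bigr => i _.
    rewrite (eE i (ltn_ord i)) (eE (N - i)%N) ?leq_subr // mulr_suml mulr_sumr.
    under eq_bigr => s _ do rewrite !mulr_sumr.
  over.
  rewrite exchange_big; apply: eq_bigr => s _.
  rewrite exchange_big; apply: eq_bigr => t _ /=.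
  case: (boolP (pent s <= N)%N) => [lesN | ].
    rewrite (bigD1 (inord (pent s))) //= inordK ?ltnS // eqxx big1 ?addr0.
      rewrite (_ : (N - pent s == pent t)%N = (N == pent s + pent t)%N); last by lia.
      by case: eqP => [-> | _]; rewrite ?addKn /=; ring.
    move=> i; rewrite -val_eqE /= inordK ?ltnS // => /negPf ->.
    by rewrite !(mulr0, mul0r).
  rewrite -ltnNge => ltNs; rewrite big1; last first.
    move=> i _; rewrite (_ : (i == pent s :> nat) = false) ?(mulr0, mul0r) //.
    by apply/eqP => ei; have := ltn_ord i; lia.
  by rewrite (_ : (N == _)%N = false) ?(mulr0, mul0r) //; lia.
under eq_bigr => s _ do under eq_bigr => t _ do rewrite WE mulrDr.
under eq_bigr => s _ do rewrite big_split.
rewrite big_split /= lattice_sum0 // add0r exchange_big /=.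
rewrite -[RHS](lattice_sum0 (leqnn N)); apply: eq_bigr => t _; apply: eq_bigr => s _.
by rewrite addnC [sgnz s * _]mulrC.
Qed.

(** * Change of coefficient ring and the substitution q -> w q *)

Section MapFps.
Variables (R S : comNzRingType) (phi : {rmorphism R -> S}).

Definition map_fps (f : fps R) : fps S := Fps (fun n => phi (f n)).

Fact map_fps_zmod : zmod_morphism map_fps.
Proof. by move=> f g; apply: fpsP => n; rewrite /= rmorphB. Qed.
HB.instance Definition _ := GRing.isZmodMorphism.Build _ _ map_fps map_fps_zmod.

Fact map_fps_monoid : monoid_morphism map_fps.
Proof.
split=> [|f g]; apply: fpsP => n; first by rewrite /= rmorph_nat.
by rewrite [LHS]/= rmorph_sum; apply: eq_bigr => i _; rewrite rmorphM.
Qed.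
HB.instance Definition _ := GRing.isMonoidMorphism.Build _ _ map_fps map_fps_monoid.

Lemma map_fpsX : map_fps (fX R) = fX S.
Proof. by apply: fpsP => n; rewrite /= rmorph_nat. Qed.

Lemma map_fpsV d f : map_fps (V d f) = V d (map_fps f).
Proof. by apply: fpsP => n /=; case: ifP => // _; rewrite rmorph0. Qed.

Lemma map_fps_euler : map_fps (euler R) = euler S.
Proof.
apply: fpsP => n.
have -> : euler S n = map_fps (euler_part R n) n.
  by rewrite rmorph_prod /=; congr (fcoef _ n); apply: eq_bigr => i _;
    rewrite rmorphB rmorph1 rmorphXn /= map_fpsX.
by [].
Qed.

Lemma map_fps_inj : injective phi -> injective map_fps.
Proof.
move=> phi_inj f g eqfg; apply: fpsP => n; apply: phi_inj.
exact: (congr1 (fun h : fps S => h n) eqfg).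
Qed.

End MapFps.

Section Twist.
Variable R : comNzRingType.
Implicit Types (w : R) (f g : fps R).

Definition twist w f := Fps (fun n => w ^+ n * f n).

Fact twist_zmod w : zmod_morphism (twist w).
Proof. by move=> f g; apply: fpsP => n; rewrite /= mulrBr. Qed.
HB.instance Definition _ w := GRing.isZmodMorphism.Build _ _ (twist w) (twist_zmod w).

Fact twist_monoid w : monoid_morphism (twist w).
Proof.
split=> [|f g]; apply: fpsP => n.
  by case: n => [|n]; rewrite /= ?mulr0 // expr0 mul1r.
rewrite [LHS]/= mulr_sumr; apply: eq_bigr => i _ /=.
by rewrite -[in w ^+ n](@subnKC i n) -1?ltnS // exprD mulrACA.
Qed.
HB.instance Definition _ w := GRing.isMonoidMorphism.Build _ _ (twist w) (twist_monoid w).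

Definition fC (c : R) : fps R := Fps (fun n => if n == 0%N then c else 0).

Lemma fCM c f n : (fC c * f) n = c * f n.
Proof.
by rewrite fpsME big_ord_recl subn0 /= big1 ?addr0 // => i _; rewrite mul0r.
Qed.

Fact fC_zmod : zmod_morphism fC.
Proof. by move=> a c; apply: fpsP => n /=; case: ifP; rewrite ?subr0. Qed.
HB.instance Definition _ := GRing.isZmodMorphism.Build _ _ fC fC_zmod.
Fact fC_monoid : monoid_morphism fC.
Proof.
split=> [|a c]; apply: fpsP => n; first by rewrite /=; case: eqP.
by rewrite fCM /=; case: ifP; rewrite ?mulr0.
Qed.
HB.instance Definition _ := GRing.isMonoidMorphism.Build _ _ fC fC_monoid.

Lemma twistX w : twist w (fX R) = fC w * fX R.
Proof.
by apply: fpsP => n; rewrite fCM /=; case: eqP => [-> |]; rewrite ?mulr0.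
Qed.

Lemma twistV d w f : w ^+ d = 1 -> twist w (V d f) = V d f.
Proof.
move=> wd; apply: fpsP => n /=; case: ifP => [/dvdnP [m ->] | _]; last by rewrite mulr0.
by rewrite mulnC exprM wd expr1n mul1r.
Qed.

Lemma eqt_twist n w f g : eqt n f g -> eqt n (twist w f) (twist w g).
Proof. by move=> eqfg i lein /=; rewrite eqfg. Qed.

Lemma eqt_V n d f g : eqt n f g -> eqt n (V d f) (V d g).
Proof.
by move=> eqfg i lein /=; case: ifP => // _; rewrite eqfg // (leq_trans (leq_div _ _)).
Qed.

Lemma eqt_exp n k f g : eqt n f g -> eqt n (f ^+ k) (g ^+ k).
Proof. by move=> eqfg; elim: k => // k IHk; rewrite !exprS; apply: eqtM. Qed.

Lemma eqt_prod n (I : Type) (r : seq I) (F G : I -> fps R) :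
  (forall i, eqt n (F i) (G i)) -> eqt n (\prod_(i <- r) F i) (\prod_(i <- r) G i).
Proof. by move=> eqFG; elim/big_rec2: _ => // i f g _; apply: eqtM. Qed.

End Twist.

(** * Norms over the fifth roots of unity *)

Section FifthRoots.
Variables (R : comNzRingType) (u : R).
Hypothesis cyc : 1 + u + u ^+ 2 + u ^+ 3 + u ^+ 4 = 0.

Lemma cyc_exp5 : u ^+ 5 = 1.
Proof.
apply/eqP; rewrite -subr_eq0; apply/eqP.
by transitivity ((u - 1) * (1 + u + u ^+ 2 + u ^+ 3 + u ^+ 4)); [ring | rewrite cyc mulr0].
Qed.

(** Pairing the factors j and 5 - j of a norm leaves only the trace t = u + u^4 and its conjugate -
    1 - t. The relation t + t^2 = 1 then removes t altogether. *)
Lemma cyc_trace : u ^+ 2 + u ^+ 3 = - 1 - (u + u ^+ 4).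
Proof. by apply/eqP; rewrite -subr_eq0 -[X in _ == X]cyc; apply/eqP; ring. Qed.

Lemma cyc_trace2 : (u + u ^+ 4) + (u + u ^+ 4) ^+ 2 = 1.
Proof.
transitivity (u + u ^+ 4 + (u ^+ 2 + u ^+ 5 * u ^+ 3) + 2 * u ^+ 5); first by ring.
by rewrite cyc_exp5 mul1r cyc_trace; ring.
Qed.

Lemma norm_1subX x : \prod_(j < 5) (1 - u ^+ j * x) = 1 - x ^+ 5.
Proof.
rewrite !big_ord_recr big_ord0 /=; set t := u + u ^+ 4.
transitivity ((1 - x) * ((1 - t * x + u ^+ 5 * x ^+ 2)
  * (1 - (u ^+ 2 + u ^+ 3) * x + u ^+ 5 * x ^+ 2))); first by rewrite /t; ring.
rewrite cyc_exp5 cyc_trace -/t.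
transitivity ((1 - x) * ((1 + x ^+ 2) ^+ 2 + (1 + x ^+ 2) * x - (t + t ^+ 2) * x ^+ 2)).
  by ring.
by rewrite cyc_trace2; ring.
Qed.

Lemma norm_trinomial a y c : a * c = - y ^+ 2 ->
  \prod_(j < 5) (a - u ^+ j * y + (u ^+ j) ^+ 2 * c) = a ^+ 5 - 11 * y ^+ 5 + c ^+ 5.
Proof.
move=> ac; rewrite !big_ord_recr big_ord0 /=; set t := u + u ^+ 4.
transitivity ((a - y + c) *
  ((a ^+ 2 + u ^+ 5 * y ^+ 2 + u ^+ 5 * u ^+ 5 * c ^+ 2 - t * (a * y)
     + (u ^+ 2 + u ^+ 5 * u ^+ 3) * (a * c) - u ^+ 5 * (u + u ^+ 4) * y * c)
 * (a ^+ 2 + u ^+ 5 * y ^+ 2 + u ^+ 5 * u ^+ 5 * c ^+ 2 - (u ^+ 2 + u ^+ 3) * (a * y)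
     + (u ^+ 4 + u ^+ 5 * u) * (a * c) - u ^+ 5 * (u ^+ 2 + u ^+ 3) * y * c))).
  by rewrite /t; ring.
rewrite cyc_exp5 !mul1r [u ^+ 4 + u]addrC !cyc_trace -/t ac.
(* The remaining product is symmetric in a and c, hence a polynomial in a + c and y once a c is
   replaced by - y^2. *)
pose s := a + c; pose S := a ^+ 2 + c ^+ 2.
have SE : S = s ^+ 2 + 2 * y ^+ 2 by rewrite -[y ^+ 2]opprK -ac /S /s; ring.
transitivity ((s - y) * ((S + 2 * y ^+ 2) * (S + y ^+ 2 + y * s)
    - (t + t ^+ 2) * (y ^+ 2 - y * s) ^+ 2)); first by rewrite /S /s; ring.
transitivity (s ^+ 5 - 5 * (a * c) * s ^+ 3 + 5 * (a * c) ^+ 2 * s - 11 * y ^+ 5).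
  by rewrite cyc_trace2 SE ac; ring.
by rewrite /s; ring.
Qed.

End FifthRoots.

Section NormEuler.
Variables (K : idomainType) (w : K).
Hypothesis wP : 5.-primitive_root w.
Local Notation q := (fX K).
Local Notation E := (euler K).

Definition norm5 (f : fps K) := \prod_(j < 5) twist (w ^+ j) f.

Lemma norm5M f g : norm5 (f * g) = norm5 f * norm5 g.
Proof. by rewrite /norm5 -big_split; apply: eq_bigr => j _; rewrite rmorphM. Qed.

Lemma cyc_prim n : ~~ (5 %| n)%N ->
  let u := fC (w ^+ n) in 1 + u + u ^+ 2 + u ^+ 3 + u ^+ 4 = 0.
Proof.
move=> ndvn u; rewrite -(rmorph1 (@fC K)) /u -!rmorphXn -!rmorphD /=.
set v := w ^+ n; suff -> : 1 + v + v ^+ 2 + v ^+ 3 + v ^+ 4 = 0 by rewrite rmorph0.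
have v1 : v - 1 != 0 by rewrite subr_eq0 -(prim_order_dvd wP).
apply: (mulfI v1); rewrite mulr0.
transitivity (v ^+ 5 - 1); first by ring.
by rewrite /v -exprM mulnC exprM (prim_expr_order wP) expr1n subrr.
Qed.

Lemma norm5_1subX n : ~~ (5 %| n)%N -> norm5 (1 - q ^+ n) = V 5 (1 - q ^+ n).
Proof.
move=> ndvn; rewrite rmorphB rmorph1 rmorphXn /= VX // -exprM mulnC exprM.
rewrite -(norm_1subX (cyc_prim ndvn)); apply: eq_bigr => j _.
rewrite rmorphB rmorph1 rmorphXn /= twistX exprMn -!rmorphXn -!exprM mulnC //.
Qed.

Lemma twist_prim j d f : (5 %| d)%N -> twist (w ^+ j) (V d f) = V d f.
Proof.
case/dvdnP=> m ->; apply: twistV.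
by rewrite -exprM mulnA mulnC exprM (prim_expr_order wP) expr1n.
Qed.

Lemma norm5V f : norm5 (V 5 f) = V 5 f ^+ 5.
Proof.
rewrite /norm5 (eq_bigr (fun=> V 5 f)) ?prodr_const ?card_ord // => j _.
exact: twist_prim.
Qed.

(** Induction by blocks of five factors: the four exponents prime to 5 have norm [V 5 (1 - q ^+ n)],
    while the factor of exponent 5 (N + 1) is a series in q^5, so its norm is a fifth power. The
    factor [V 25] supplies the missing multiples of 5 in [V 5]. *)
Lemma norm5_euler_part N :
  norm5 (euler_part K (5 * N)) * V 25 (euler_part K N)
  = V 5 (euler_part K (5 * N)) * V 5 (euler_part K N) ^+ 5.
Proof.
elim: N => [|N IHN].
  rewrite muln0 /euler_part !big_ord0 !rmorph1 expr1n !mulr1.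
  by rewrite /norm5 big1 // => j _; rewrite rmorph1.
have -> : (5 * N.+1 = (5 * N).+4.+1)%N by lia.
rewrite !euler_partS; set P := euler_part K (5 * N) in IHN *.
have n1 : ~~ (5 %| (5 * N).+1)%N by lia.
have n2 : ~~ (5 %| (5 * N).+2)%N by lia.
have n3 : ~~ (5 %| (5 * N).+3)%N by lia.
have n4 : ~~ (5 %| (5 * N).+4)%N by lia.
have V5X : 1 - q ^+ (5 * N).+4.+1 = V 5 (1 - q ^+ N.+1).
  rewrite rmorphB rmorph1 rmorphXn /= VX // -exprM; congr (_ - _ ^+ _); lia.
rewrite V5X !norm5M !rmorphM /= !norm5_1subX // norm5V VV //.
set A := V 5 (1 - _); set B := V 5 (1 - _); set C := V 5 (1 - _); set D := V 5 (1 - _).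
move: IHN; set X := norm5 P; set Y := V 5 P; set Z := V 25 _; set T := V 5 (euler_part _ _).
set G := V 5 (1 - _); set H := V (5 * 5) _ => IHN.
transitivity (X * Z * (A * B * C * D * G ^+ 5 * H)).
  by rewrite /H; ring.
by rewrite IHN; ring.
Qed.

Lemma norm5_euler : norm5 E * V 25 E = V 5 E ^+ 6.
Proof.
apply: eqt_fps => n; have := euler_trunc K (leqnn n).
have := @euler_trunc K n (5 * n)%N; rewrite leq_pmull // => /(_ isT) e5 e1 i lein.
transitivity ((norm5 (euler_part K (5 * n)) * V 25 (euler_part K n)) i).
  apply: (@eqtM _ n) => //; last by apply: eqt_V.
  by apply: eqt_prod => j; apply: eqt_twist.
rewrite norm5_euler_part [V 5 E ^+ 6]exprS; symmetry.
by apply: (@eqtM _ n) => //; [|apply: eqt_exp]; apply: eqt_V.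
Qed.

End NormEuler.

(** * The modular equation for [E(q) / (q E(q^25))] *)

Lemma norm5_dissection (K : idomainType) (w : K) (a b c : fps K) :
  5.-primitive_root w ->
  let y := fX K * V 5 b in let g := fX K ^+ 2 * V 5 c in
  V 5 a * g = - y ^+ 2 ->
  norm5 w (V 5 a - y + g) = V 5 (a ^+ 5 - 11 * fX K * b ^+ 5 + fX K ^+ 2 * c ^+ 5).
Proof.
move=> wP y g ag.
have cyc := cyc_prim wP (n := 1) isT; rewrite expr1 in cyc.
transitivity (V 5 a ^+ 5 - 11 * y ^+ 5 + g ^+ 5).
  rewrite -(norm_trinomial cyc ag); apply: eq_bigr => j _.
  rewrite rmorphD rmorphB /y /g !(rmorphXn, rmorphM) /= twistX !(twist_prim wP) //.
  by rewrite rmorphXn; ring.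
rewrite rmorphD rmorphB !(rmorphXn, rmorphM) /= VX // rmorph_nat /y /g; ring.
Qed.

Lemma euler_modular_int :
  let E := euler int in let q := fX int in let y := q * V 5 (V 5 E) in
  exists a c N : fps int, let g := q ^+ 2 * V 5 c in
  [/\ E = V 5 a - y + g, V 5 a * g = - y ^+ 2,
      V 5 N = V 5 a ^+ 5 - 11 * y ^+ 5 + g ^+ 5 & N * V 5 E = E ^+ 6].
Proof.
move=> E q y; pose a := Uc 0 E; pose c := Uc 2 E.
pose N := a ^+ 5 - 11 * q * V 5 E ^+ 5 + q ^+ 2 * c ^+ 5.
have p0 : part5 0 E = V 5 a by rewrite part5E // mulr1.
have p1 : part5 1 E = - y by rewrite part5E // euler_Uc1 rmorphN mulNr mulrC expr1.
have p2 : part5 2 E = q ^+ 2 * V 5 c by rewrite part5E // mulrC.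
have eE : E = V 5 a - y + q ^+ 2 * V 5 c by rewrite {1}/E euler_part5_sum p0 p1 p2.
have ac : V 5 a * (q ^+ 2 * V 5 c) = - y ^+ 2.
  by rewrite -p0 -p2 euler_part5_rel p1 sqrrN.
exists a, c, N; split=> //.
  rewrite rmorphD rmorphB !(rmorphXn, rmorphM) /= VX // rmorph_nat /y /q; ring.
apply: (@V_inj _ 5) => //; rewrite rmorphM rmorphXn /=.
apply: (@map_fps_inj _ _ (intr : {rmorphism int -> algC})); first exact: intr_inj.
have [w wP] := C_prim_root_exists (isT : (0 < 5)%N).
rewrite rmorphM rmorphXn /= !map_fpsV map_fps_euler.
rewrite -(norm5_euler wP) [in RHS]mulrC VV // mulrC; congr (_ * _).
have mE : euler algC = V 5 (map_fps intr a) - fX algC * V 5 (map_fps intr (V 5 E))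
           + fX algC ^+ 2 * V 5 (map_fps intr c).
  have := congr1 (map_fps (intr : {rmorphism int -> algC})) eE.
  rewrite map_fps_euler => ->.
  by rewrite rmorphD rmorphB !(rmorphXn, rmorphM) /= map_fpsX !map_fpsV.
rewrite mE (norm5_dissection wP).
  by rewrite /N rmorphD rmorphB !(rmorphXn, rmorphM) /= map_fpsX rmorph_nat.
have := congr1 (map_fps (intr : {rmorphism int -> algC})) ac.
by rewrite rmorphN !(rmorphXn, rmorphM) /= map_fpsX !map_fpsV.
Qed.

(** Integral identities pass to every ring along [intr], in particular to characteristic 17. *)
Lemma euler_modular (R : comNzRingType) :
  let E := euler R in let q := fX R in let y := q * V 5 (V 5 E) in
  exists a c N : fps R, let g := q ^+ 2 * V 5 c in
  [/\ E = V 5 a - y + g, V 5 a * g = - y ^+ 2,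
      V 5 N = V 5 a ^+ 5 - 11 * y ^+ 5 + g ^+ 5 & N * V 5 E = E ^+ 6].
Proof.
move=> E q y; have [a [c [N [eE ac eN NE]]]] := euler_modular_int.
pose m := map_fps (intr : {rmorphism int -> R}).
have mY : m (fX int * V 5 (V 5 (euler int))) = y.
  by rewrite /m rmorphM /= map_fpsX !map_fpsV map_fps_euler.
have mG : m (fX int ^+ 2 * V 5 c) = q ^+ 2 * V 5 (m c).
  by rewrite /m rmorphM rmorphXn /= map_fpsX map_fpsV.
exists (m a), (m c), (m N); split.
- by rewrite -mG -mY /m -map_fpsV -rmorphB -rmorphD /= -eE map_fps_euler.
- by rewrite -mG -mY /m -map_fpsV -rmorphM /= ac rmorphN rmorphXn.
- by rewrite -mG -mY /m -!map_fpsV eN rmorphD rmorphB !(rmorphXn, rmorphM) rmorph_nat.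
- by rewrite /E /m -(map_fps_euler (intr : {rmorphism int -> R})) -map_fpsV -rmorphM /= NE rmorphXn.
Qed.

(** * Newton's recursion for [U] of the powers of [E] *)

Section PowerSums.
Variable R : comNzRingType.
Variables E y A g N z : fps R.
Hypothesis eE : E = A - y + g.
Hypothesis Ag : A * g = - y ^+ 2.
Hypothesis eN : V 5 N = A ^+ 5 - 11 * y ^+ 5 + g ^+ 5.
Hypothesis ez : y ^+ 5 = V 5 z.
Let D i := A ^+ i * y ^+ (5 - i) + g ^+ i * y ^+ (5 - i).
Hypothesis UD : forall i, (0 < i < 5)%N -> U 5 (D i) = 0.

Lemma U_shift j k : U 5 (y ^+ j.+4.+1 * E ^+ k) = z * U 5 (y ^+ j * E ^+ k).
Proof. by rewrite -UV_mul // -ez mulrA -exprD. Qed.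

(** By A g = - y^2, the norm is a polynomial in A + g and y; substituting A + g = E + y gives the
    quintic equation. *)
Lemma V_modular : V 5 N = E ^+ 5 + 5 * y * E ^+ 4 + 15 * y ^+ 2 * E ^+ 3
  + 25 * y ^+ 3 * E ^+ 2 + 25 * y ^+ 4 * E.
Proof.
pose s := A + g.
have -> : E = s - y by rewrite eE /s; ring.
transitivity (s ^+ 5 - 5 * (A * g) * s ^+ 3 + 5 * (A * g) ^+ 2 * s
  - 11 * y ^+ 5); first by rewrite eN /s; ring.
by rewrite Ag; ring.
Qed.

Lemma U_rec k j : U 5 (y ^+ j * E ^+ k.+4.+1) = N * U 5 (y ^+ j * E ^+ k)
  - (U 5 (y ^+ j.+1 * E ^+ k.+4)) *+ 5 - (U 5 (y ^+ j.+2 * E ^+ k.+3)) *+ 15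
  - (U 5 (y ^+ j.+3 * E ^+ k.+2)) *+ 25 - (U 5 (y ^+ j.+4 * E ^+ k.+1)) *+ 25.
Proof.
rewrite -UV_mul // -!raddfMn -!raddfB /= V_modular; congr (U 5 _).
by rewrite !exprS; ring.
Qed.

Lemma U_pow0 : U 5 (y ^+ 0 * E ^+ 0) = 1.
Proof. by rewrite !expr0 mulr1 -(rmorph1 (V 5)) UV // rmorph1. Qed.

Lemma U_y5 : U 5 (y ^+ 5) = z.
Proof. by rewrite ez UV. Qed.

(** In this and the next three lemmas the argument is homogeneous of degree 5. With A g = - y^2 it
    becomes a combination of the [D i], which [U 5] kills, and of y^5, which alone survives. *)
Lemma U_pow1 : U 5 (y ^+ 4 * E ^+ 1) = - z.
Proof.
have -> : y ^+ 4 * E ^+ 1 = D 1 - y ^+ 5 by rewrite eE /D /=; ring.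
by rewrite raddfB /= UD // U_y5 sub0r.
Qed.

Lemma U_pow2 : U 5 (y ^+ 3 * E ^+ 2) = - z.
Proof.
have -> : y ^+ 3 * E ^+ 2 = D 2 - D 1 *+ 2 - y ^+ 5.
  transitivity (y ^+ 3 * (A ^+ 2 + g ^+ 2 + 2 * (A * g) - 2 * y * (A + g) + y ^+ 2)).
    by rewrite eE; ring.
  by rewrite Ag /D /=; ring.
by rewrite !raddfB raddfMn /= !UD // U_y5; ring.
Qed.

Lemma U_pow3 : U 5 (y ^+ 2 * E ^+ 3) = 5 * z.
Proof.
have -> : y ^+ 2 * E ^+ 3 = D 3 - D 2 *+ 3 + y ^+ 5 *+ 5.
  transitivity (y ^+ 2 * (A ^+ 3 + g ^+ 3 + 3 * (A * g) * (A + g)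
    - 3 * y * (A ^+ 2 + g ^+ 2) - 6 * y * (A * g) + 3 * y ^+ 2 * (A + g) - y ^+ 3)).
    by rewrite eE; ring.
  by rewrite Ag /D /=; ring.
by rewrite raddfD raddfB !raddfMn /= !UD // U_y5; ring.
Qed.

Lemma U_pow4 : U 5 (y ^+ 1 * E ^+ 4) = - 5 * z.
Proof.
have -> : y ^+ 1 * E ^+ 4 = D 4 - D 3 *+ 4 + D 2 *+ 2 + D 1 *+ 8 - y ^+ 5 *+ 5.
  transitivity (y * (A ^+ 4 + g ^+ 4 + 4 * (A * g) * (A ^+ 2 + g ^+ 2)
    + 6 * (A * g) ^+ 2 - 4 * y * (A ^+ 3 + g ^+ 3) - 12 * y * (A * g) * (A + g)
    + 6 * y ^+ 2 * (A ^+ 2 + g ^+ 2) + 12 * y ^+ 2 * (A * g)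
    - 4 * y ^+ 3 * (A + g) + y ^+ 4)); first by rewrite eE; ring.
  by rewrite Ag /D /=; ring.
by rewrite raddfB raddfD raddfD raddfB !raddfMn /= !UD // U_y5; ring.
Qed.

End PowerSums.

(* [u j k] stands for [U 5 (y ^+ j * E ^+ k)], kept abstract so that distinct
   powers are not compared by unfolding. *)
Section NewtonTable.
Variable R : comNzRingType.
Variables (N z : fps R) (u : nat -> nat -> fps R).
Hypothesis U_shift : forall j k, u j.+4.+1 k = z * u j k.
Hypothesis U_rec : forall k j, u j k.+4.+1 = N * u j k
  - u j.+1 k.+4 *+ 5 - u j.+2 k.+3 *+ 15 - u j.+3 k.+2 *+ 25 - u j.+4 k.+1 *+ 25.
Hypothesis newton0 : u 0 0 = 1.
Hypothesis newton1 : u 4 1 = - z.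
Hypothesis newton2 : u 3 2 = - z.
Hypothesis newton3 : u 2 3 = 5 * z.
Hypothesis newton4 : u 1 4 = - 5 * z.

(** The table runs through the entries with j < 5 and j + k divisible by 5. Each follows from the
    preceding five by [U_rec], with indices j >= 5 folded back by [U_shift]. *)
Lemma newton5 : u 0 5 = N.
Proof.
transitivity (N * u 0 0
  - (u 1 4) *+ 5
  - (u 2 3) *+ 15
  - (u 3 2) *+ 25
  - (u 4 1) *+ 25).
  exact: (U_rec 0 0).
by rewrite newton4 newton3 newton2 newton1 newton0; ring.
Qed.

Lemma newton6 : u 4 6 = - 25 * z ^+ 2 - 6 * N * z.
Proof.
transitivity (N * u 4 1
  - (z * u 0 5) *+ 5
  - (z * u 1 4) *+ 15
  - (z * u 2 3) *+ 25
  - (z * u 3 2) *+ 25).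
  rewrite -!U_shift; exact: (U_rec 1 4).
by rewrite newton5 newton4 newton3 newton2 newton1; ring.
Qed.

Lemma newton7 : u 3 7 = 125 * z ^+ 2 + 14 * N * z.
Proof.
transitivity (N * u 3 2
  - (u 4 6) *+ 5
  - (z * u 0 5) *+ 15
  - (z * u 1 4) *+ 25
  - (z * u 2 3) *+ 25).
  rewrite -!U_shift; exact: (U_rec 2 3).
by rewrite newton6 newton5 newton4 newton3 newton2; ring.
Qed.

Lemma newton8 : u 2 8 = - 125 * z ^+ 2.
Proof.
transitivity (N * u 2 3
  - (u 3 7) *+ 5
  - (u 4 6) *+ 15
  - (z * u 0 5) *+ 25
  - (z * u 1 4) *+ 25).
  rewrite -!U_shift; exact: (U_rec 3 2).
by rewrite newton7 newton6 newton5 newton4 newton3; ring.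
Qed.

Lemma newton9 : u 1 9 = - 625 * z ^+ 2 - 90 * N * z.
Proof.
transitivity (N * u 1 4
  - (u 2 8) *+ 5
  - (u 3 7) *+ 15
  - (u 4 6) *+ 25
  - (z * u 0 5) *+ 25).
  rewrite -!U_shift; exact: (U_rec 4 1).
by rewrite newton8 newton7 newton6 newton5 newton4; ring.
Qed.

Lemma newton10 : u 0 10 = 625 * 4 * z ^+ 2 + 250 * N * z + N ^+ 2.
Proof.
transitivity (N * u 0 5
  - (u 1 9) *+ 5
  - (u 2 8) *+ 15
  - (u 3 7) *+ 25
  - (u 4 6) *+ 25).
  exact: (U_rec 5 0).
by rewrite newton9 newton8 newton7 newton6 newton5; ring.
Qed.

Lemma newton11 : u 4 11 = - 625 * 5 * z ^+ 3 - 275 * N * z ^+ 2 - 11 * N ^+ 2 * z.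
Proof.
transitivity (N * u 4 6
  - (z * u 0 10) *+ 5
  - (z * u 1 9) *+ 15
  - (z * u 2 8) *+ 25
  - (z * u 3 7) *+ 25).
  rewrite -!U_shift; exact: (U_rec 6 4).
by rewrite newton10 newton9 newton8 newton7 newton6; ring.
Qed.

Lemma newton12 : u 3 12 = - 625 * 5 * z ^+ 3 + 54 * N ^+ 2 * z.
Proof.
transitivity (N * u 3 7
  - (u 4 11) *+ 5
  - (z * u 0 10) *+ 15
  - (z * u 1 9) *+ 25
  - (z * u 2 8) *+ 25).
  rewrite -!U_shift; exact: (U_rec 7 3).
by rewrite newton11 newton10 newton9 newton8 newton7; ring.
Qed.

Lemma newton13 : u 2 13 = 625 * 25 * z ^+ 3 - 130 * N ^+ 2 * z.
Proof.
transitivity (N * u 2 8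
  - (u 3 12) *+ 5
  - (u 4 11) *+ 15
  - (z * u 0 10) *+ 25
  - (z * u 1 9) *+ 25).
  rewrite -!U_shift; exact: (U_rec 8 2).
by rewrite newton12 newton11 newton10 newton9 newton8; ring.
Qed.

Lemma newton14 : u 1 14 = - 625 * 25 * z ^+ 3.
Proof.
transitivity (N * u 1 9
  - (u 2 13) *+ 5
  - (u 3 12) *+ 15
  - (u 4 11) *+ 25
  - (z * u 0 10) *+ 25).
  rewrite -!U_shift; exact: (U_rec 9 1).
by rewrite newton13 newton12 newton11 newton10 newton9; ring.
Qed.

Lemma newton15 : u 0 15 = 625 * 15 * N * z ^+ 2 + 125 * 9 * N ^+ 2 * z + N ^+ 3.
Proof.
transitivity (N * u 0 10
  - (u 1 14) *+ 5
  - (u 2 13) *+ 15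
  - (u 3 12) *+ 25
  - (u 4 11) *+ 25).
  exact: (U_rec 10 0).
by rewrite newton14 newton13 newton12 newton11 newton10; ring.
Qed.

Lemma newton16 : u 4 16 = - 625 * 125 * z ^+ 4 - 625 * 80 * N * z ^+ 3 - 125 * 32 * N ^+ 2 * z ^+ 2 - 16 * N ^+ 3 * z.
Proof.
transitivity (N * u 4 11
  - (z * u 0 15) *+ 5
  - (z * u 1 14) *+ 15
  - (z * u 2 13) *+ 25
  - (z * u 3 12) *+ 25).
  rewrite -!U_shift; exact: (U_rec 11 4).
by rewrite newton15 newton14 newton13 newton12 newton11; ring.
Qed.

Lemma newton17 : u 3 17 = 625 * 625 * z ^+ 4 + 625 * 170 * N * z ^+ 3 + 125 * 51 * N ^+ 2 * z ^+ 2 + 119 * N ^+ 3 * z.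
Proof.
transitivity (N * u 3 12
  - (u 4 16) *+ 5
  - (z * u 0 15) *+ 15
  - (z * u 1 14) *+ 25
  - (z * u 2 13) *+ 25).
  rewrite -!U_shift; exact: (U_rec 12 3).
by rewrite newton16 newton15 newton14 newton13 newton12; ring.
Qed.

Lemma newton18 : u 2 18 = - 625 * 625 * z ^+ 4 - 510 * N ^+ 3 * z.
Proof.
transitivity (N * u 2 13
  - (u 3 17) *+ 5
  - (u 4 16) *+ 15
  - (z * u 0 15) *+ 25
  - (z * u 1 14) *+ 25).
  rewrite -!U_shift; exact: (U_rec 13 2).
by rewrite newton17 newton16 newton15 newton14 newton13; ring.
Qed.

Hypothesis c17 : (17%:R : fps R) = 0.

(** Reduction modulo 17 with an explicit quotient [h], so that [ring] only has to check an identity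
    with integer coefficients. *)
Lemma mod17 (f g h : fps R) : f = g + 17%:R * h -> f = g.
Proof. by rewrite c17 mul0r addr0. Qed.

Lemma newton6_mod17 : u 4 6 = 9 * z ^+ 2 + 11 * N * z.
Proof. by rewrite newton6; apply: (@mod17 _ _ (- 2 * z ^+ 2 - N * z)); ring. Qed.

Lemma newton10_mod17 : u 0 10 = z ^+ 2 + 12 * N * z + N ^+ 2.
Proof. by rewrite newton10; apply: (@mod17 _ _ (147 * z ^+ 2 + 14 * N * z)); ring. Qed.

Lemma newton12_mod17 : u 3 12 = 3 * z ^+ 3 + 3 * N ^+ 2 * z.
Proof. by rewrite newton12; apply: (@mod17 _ _ (- 184 * z ^+ 3 + 3 * N ^+ 2 * z)); ring. Qed.

Lemma newton16_mod17 :
  u 4 16 = 7 * z ^+ 4 + 14 * N * z ^+ 3 + 12 * N ^+ 2 * z ^+ 2 + N ^+ 3 * z.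
Proof.
rewrite newton16; apply: (@mod17 _ _ (- (4 * 919 + 920) * z ^+ 4
  - (3 * 735 + 737) * N * z ^+ 3 - 236 * N ^+ 2 * z ^+ 2 - N ^+ 3 * z)); ring.
Qed.

Lemma newton18_mod17 : u 2 18 = z ^+ 4.
Proof.
rewrite newton18; apply: (@mod17 _ _ (- (22 * 1000 + 978) * z ^+ 4 - 30 * N ^+ 3 * z)); ring.
Qed.

End NewtonTable.

(** * The three operators applied to E^16 modulo 17 *)

Section ThreeSteps.
Variable R : comNzRingType.
Local Notation q := (fX R).
Local Notation E := (euler R).
Local Notation b := (V 5 (euler R)).
Hypothesis c17 : (17%:R : fps R) = 0.

(** Shifting by 5 - c moves the exponent 5 n + c to 5 (n + 1), which turns [Uc c] into [U 5] at the
    cost of a factor q. *)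
Lemma U_pred c (f : fps R) : (0 < c < 5)%N -> U 5 (q ^+ (5 - c) * f) = q * Uc c f.
Proof.
case/andP=> c_gt0 c_lt5; apply: fpsP => n; rewrite fXM [LHS]fXnM.
case: n => [|n]; first by rewrite ifT //; lia.
by rewrite ifF; [congr (f _) |]; lia.
Qed.

Lemma fX_unit_lreg (h f g : fps R) : h 0%N = 1 -> q * h * f = q * h * g -> f = g.
Proof. by move=> h0; rewrite -!mulrA => /fX_inj; apply: fps_unit_lreg. Qed.

Lemma three_steps : Uc 1 (Uc 3 (Uc 1 (E ^+ 16))) = 2 * q ^+ 3 * b ^+ 16.
Proof.
have [a [c [N [eE ag eN NE]]]] := euler_modular R.
set y : fps R := q * V 5 b in eE ag eN; set g : fps R := q ^+ 2 * V 5 c in eE ag eN.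
pose z : fps R := q * b ^+ 5; pose u j k : fps R := U 5 (y ^+ j * E ^+ k).
have ez : y ^+ 5 = V 5 z by rewrite /z rmorphM rmorphXn /= VX // exprMn.
(* Modulo 5 the exponents in the two summands are 5 - i and i, never 0. *)
have UD i : (0 < i < 5)%N ->
    U 5 (V 5 a ^+ i * y ^+ (5 - i) + g ^+ i * y ^+ (5 - i)) = 0.
  case/andP=> i_gt0 i_lt5; rewrite raddfD /=.
  have -> : V 5 a ^+ i * y ^+ (5 - i) = V 5 (a ^+ i * b ^+ (5 - i)) * q ^+ (5 - i).
    by rewrite rmorphM !rmorphXn /= exprMn mulrAC mulrA.
  have -> : g ^+ i * y ^+ (5 - i) = V 5 (c ^+ i * b ^+ (5 - i)) * q ^+ (2 * i + (5 - i)).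
    by rewrite rmorphM !rmorphXn /= [g ^+ i]exprMn [y ^+ _]exprMn exprD exprM mulrACA mulrC.
  by rewrite !UX_V ?addr0 //; lia.
have U_sh j k : u j.+4.+1 k = z * u j k.
  by apply: U_shift.
have U_rc k j : u j k.+4.+1 = N * u j k
    - u j.+1 k.+4 *+ 5 - u j.+2 k.+3 *+ 15 - u j.+3 k.+2 *+ 25 - u j.+4 k.+1 *+ 25.
  exact: U_rec eE ag eN k j.
have u0 : u 0%N 0%N = 1 by apply: U_pow0.
have u1 : u 4 1 = - z by exact: (U_pow1 eE ez UD).
have u2 : u 3 2 = - z by exact: (U_pow2 eE ag ez UD).
have u3 : u 2 3 = 5 * z by exact: (U_pow3 eE ag ez UD).
have u4 : u 1 4 = - 5 * z by exact: (U_pow4 eE ag ez UD).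
have VNE := V_modular eE ag eN.
(* The cofactor of E in the modular equation, which plays the role of [V 5 N] divided by E. *)
pose Q : fps R := E ^+ 4 + 5 * y * E ^+ 3 + 15 * y ^+ 2 * E ^+ 2 + 25 * y ^+ 3 * E + 25 * y ^+ 4.
have {}VNE : V 5 N = E * Q by rewrite VNE /Q; ring.
have u5 : u 0 5 = N := newton5 U_rc u0 u1 u2 u3 u4.
have u6' := newton6 U_sh U_rc u0 u1 u2 u3 u4.
have u6 := newton6_mod17 U_sh U_rc u0 u1 u2 u3 u4 c17.
have u7 := newton7 U_sh U_rc u0 u1 u2 u3 u4.
have u8 := newton8 U_sh U_rc u0 u1 u2 u3 u4.
have u10 := newton10_mod17 U_sh U_rc u0 u1 u2 u3 u4 c17.
have u12 := newton12_mod17 U_sh U_rc u0 u1 u2 u3 u4 c17.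
have u16 := newton16_mod17 U_sh U_rc u0 u1 u2 u3 u4 c17.
have u18 := newton18_mod17 U_sh U_rc u0 u1 u2 u3 u4 c17.
have uV j k f : U 5 (V 5 f * (y ^+ j * E ^+ k)) = f * u j k by rewrite UV_mul.
have uVn f j k n : U 5 (V 5 f * (y ^+ j * E ^+ k) *+ n) = f * u j k *+ n.
  by rewrite raddfMn /= uV.
have lin (f h f' h' : fps R) : U 5 f = f' -> U 5 h = h' -> U 5 (f + h) = f' + h'.
  by move=> <- <-; rewrite raddfD.
clearbody u.
have Vmono i j k : V 5 (E ^+ i * b ^+ j * N ^+ k) = b ^+ i * V 5 b ^+ j * (E * Q) ^+ k.
  by rewrite !rmorphM !rmorphXn /= VNE.
have b0 : b 0%N = 1 by rewrite V_coef0 euler0.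
have N0 : N 0%N = 1.
  have := congr1 (fun f : fps R => f 0%N) NE.
  by rewrite fpsM0 b0 mulr1 fpsX0 ?euler0.
have E6 : E ^+ 6 = N * b by rewrite NE.
have E12 : E ^+ 12 = (N * b) ^+ 2 by rewrite NE -exprM.
have E18 : E ^+ 18 = (N * b) ^+ 3 by rewrite NE -exprM.
set G1 := Uc 1 (E ^+ 16); set G2 := Uc 3 G1; set G3 := Uc 1 G2.
(* Multiplying by [V 5] of a suitable power of [b] makes every term homogeneous
   in [y] and [E] of degree divisible by 5, so that the table applies. *)
have eG1 : b ^+ 2 * G1 = 7 * q ^+ 3 * b ^+ 18 + 14 * E ^+ 6 * q ^+ 2 * b ^+ 12
    + 12 * E ^+ 12 * q * b ^+ 6 + E ^+ 18.
  apply: (@fX_unit_lreg (b ^+ 4)); first by rewrite fpsX0.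
  transitivity (b ^+ 2 * (b ^+ 4 * (q * G1))); first by ring.
  have -> : b ^+ 4 * (q * G1) = u 4 16.
    rewrite -(U_pred _ (isT : (0 < 1 < 5)%N)) -UV_mul // -[u 4 16]mul1r -uV.
    by rewrite rmorph1 rmorphXn /= mul1r mulrA [V 5 b ^+ 4 * _]mulrC -exprMn.
  by rewrite u16 E6 E12 E18 /z; ring.
have eG2 : E ^+ 2 * G2 = 10 * E ^+ 18 + 7 * E ^+ 12 * q * b ^+ 6
    + 2 * E ^+ 6 * q ^+ 2 * b ^+ 12 + q ^+ 3 * b ^+ 18.
  apply: (@fX_unit_lreg (b ^+ 5)); first by rewrite fpsX0.
  transitivity ((b ^+ 5 * E ^+ 2) * (q * G2)); first by ring.
  rewrite -(U_pred _ (isT : (0 < 3 < 5)%N)) -UV_mul // -/G1.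
  have -> : V 5 (b ^+ 5 * E ^+ 2) * (q ^+ (5 - 3) * G1)
     = (V 5 (E ^+ 18 * b ^+ 0 * N ^+ 0) * (y ^+ 5 * E ^+ 0)) *+ 7
       + (V 5 (E ^+ 12 * b ^+ 1 * N ^+ 0) * (y ^+ 4 * E ^+ 6)) *+ 14
       + (V 5 (E ^+ 6 * b ^+ 2 * N ^+ 0) * (y ^+ 3 * E ^+ 12)) *+ 12
       + (V 5 (E ^+ 0 * b ^+ 3 * N ^+ 0) * (y ^+ 2 * E ^+ 18)) *+ 1.
    transitivity (q ^+ 2 * V 5 b ^+ 5 * (b ^+ 2 * G1)).
      by rewrite rmorphM !rmorphXn /=; ring.
    by rewrite eG1 !Vmono /y; ring.
  rewrite (lin _ _ _ _ (lin _ _ _ _ (lin _ _ _ _ (uVn _ _ _ _) (uVn _ _ _ _))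
    (uVn _ _ _ _)) (uVn _ _ _ _)) !U_sh u0 u6 u12 u18.
  apply: (@mod17 _ c17 _ _ (11 * N ^+ 3 * b ^+ 3 * z + 7 * N ^+ 2 * b ^+ 3 * z ^+ 2
     + 2 * N * b ^+ 3 * z ^+ 3)).
  by rewrite E6 E12 E18 /z; ring.
(* Only [E ^+ 2 * G2] is polynomial; multiplying by [V 5 N ^+ 2 = (E * Q) ^+ 2]
   removes the denominator. *)
apply: (@fX_unit_lreg (N ^+ 2 * b ^+ 7)); first by rewrite fpsM0 !fpsX0 // mulr1.
transitivity ((N ^+ 2 * b ^+ 7) * (q * G3)); first by ring.
rewrite -(U_pred _ (isT : (0 < 1 < 5)%N)) -UV_mul // -/G2.
(* Three terms of [eG2] contain E^2, which joins Q^2 to restore [V 5 N ^+ 2]. The last term has no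
   factor E, so Q^2 is expanded there; its coefficients are 1, 10, 55, ..., 625. *)
have -> : V 5 (N ^+ 2 * b ^+ 7) * (q ^+ (5 - 1) * G2)
   = (V 5 (E ^+ 0 * b ^+ 3 * N ^+ 2) * (y ^+ 4 * E ^+ 16)) *+ 10
     + (V 5 (E ^+ 6 * b ^+ 2 * N ^+ 2) * (y ^+ 5 * E ^+ 10)) *+ 7
     + (V 5 (E ^+ 12 * b ^+ 1 * N ^+ 2) * (y ^+ 6 * E ^+ 4)) *+ 2
     + (V 5 (E ^+ 18 * b ^+ 0 * N ^+ 0) * (y ^+ 7 * E ^+ 8)) *+ 1
     + (V 5 (E ^+ 18 * b ^+ 0 * N ^+ 0) * (y ^+ 8 * E ^+ 7)) *+ 10
     + (V 5 (E ^+ 18 * b ^+ 0 * N ^+ 0) * (y ^+ 9 * E ^+ 6)) *+ 55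
     + (V 5 (E ^+ 18 * b ^+ 0 * N ^+ 0) * (y ^+ 10 * E ^+ 5)) *+ 200
     + (V 5 (E ^+ 18 * b ^+ 0 * N ^+ 0) * (y ^+ 11 * E ^+ 4)) *+ 525
     + (V 5 (E ^+ 18 * b ^+ 0 * N ^+ 0) * (y ^+ 12 * E ^+ 3)) *+ 1000
     + (V 5 (E ^+ 18 * b ^+ 0 * N ^+ 0) * (y ^+ 13 * E ^+ 2)) *+ 1375
     + (V 5 (E ^+ 18 * b ^+ 0 * N ^+ 0) * (y ^+ 14 * E ^+ 1)) *+ 1250
     + (V 5 (E ^+ 18 * b ^+ 0 * N ^+ 0) * (y ^+ 15 * E ^+ 0)) *+ 625.
  transitivity (q ^+ 4 * V 5 b ^+ 7 * Q ^+ 2 * (E ^+ 2 * G2)).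
    by rewrite rmorphM !rmorphXn /= VNE; ring.
  by rewrite eG2 !Vmono /Q /y; ring.
rewrite (lin _ _ _ _ (lin _ _ _ _ (lin _ _ _ _ (lin _ _ _ _ (lin _ _ _ _ (lin _ _ _ _
  (lin _ _ _ _ (lin _ _ _ _ (lin _ _ _ _ (lin _ _ _ _ (lin _ _ _ _ (uVn _ _ _ _)
  (uVn _ _ _ _)) (uVn _ _ _ _)) (uVn _ _ _ _)) (uVn _ _ _ _)) (uVn _ _ _ _))
  (uVn _ _ _ _)) (uVn _ _ _ _)) (uVn _ _ _ _)) (uVn _ _ _ _)) (uVn _ _ _ _))
  (uVn _ _ _ _)).
rewrite !U_sh u0 u1 u2 u3 u4 u5 u6' u7 u8 u10 u16.
(* Modulo 17 everything cancels except 2 b^3 N^2 z^4. *)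
apply: (@mod17 _ c17 _ _ (b ^+ 3 * N ^+ 2
  * (4 * z ^+ 4 + 16 * N * z ^+ 3 + 12 * N ^+ 2 * z ^+ 2 + N ^+ 3 * z))).
by rewrite E6 E12 E18 /z; ring.
Qed.

End ThreeSteps.

(** * Regular partitions *)

Section Partitions.
Variable l : nat.
Hypothesis l_gt0 : (0 < l)%N.

Definition regular_parts m n : seq (seq nat) :=
  [seq s <- undup (seqs_upto n n) |
    [&& is_partition n s, is_regular l s & all (leq^~ m) s]].

Lemma mem_seqs_upto len m s :
  (size s <= len)%N -> all (fun x => 0 < x <= m)%N s -> s \in seqs_upto len m.
Proof.
elim: len s => [|len IHlen] [|x s] //= le_s /andP[x_m s_m].
rewrite inE; apply/orP; right; apply/allpairsP; exists (x, s) => /=.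
by split=> //; [rewrite mem_iota; lia | apply: IHlen].
Qed.

Lemma partition_bounds n s : is_partition n s ->
  (size s <= n)%N /\ all (fun x => 0 < x <= n)%N s.
Proof.
case/and3P => _ + /eqP <-; elim: s => //= x s IHs /andP[x_gt0 /IHs[le_s s_n]].
split; first by lia.
apply/andP; split; first by lia.
by apply: sub_all s_n => y; lia.
Qed.

Lemma mem_regular_parts m n s : (s \in regular_parts m n)
  = [&& is_partition n s, is_regular l s & all (leq^~ m) s].
Proof.
rewrite mem_filter; case: and3P => // -[ps _ _] /=.
by have [? ?] := partition_bounds ps; rewrite mem_undup mem_seqs_upto.
Qed.

Lemma regular_parts_uniq m n : uniq (regular_parts m n).
Proof. by rewrite filter_uniq ?undup_uniq. Qed.

Lemma regular_parts_widen m n : (n <= m)%N -> size (regular_parts m n) = b l n.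
Proof.
move=> lenm; rewrite /regular_parts size_filter; apply: eq_count => s.
case ps: (is_partition n s) => //=; rewrite -[RHS]andbT; congr (_ && _).
have [_ s_n] := partition_bounds ps.
by apply: sub_all s_n => x; lia.
Qed.

Lemma regular_parts0 n : size (regular_parts 0 n) = (n == 0)%N.
Proof.
case: n => // n; apply/eqP; rewrite size_eq0 -[_ == _]negbK -has_filter.
apply/hasPn => s _; apply/and3P => -[/and3P[_ s_gt0 /eqP s_n] _].
by case: s s_gt0 s_n => //= x s; lia.
Qed.

(** Either all parts are at most [m], or the head of the decreasing list is [m.+1] and is
    removed. *)
Lemma regular_partsS m n : size (regular_parts m.+1 n) =
  (size (regular_parts m n) + (if ~~ (l %| m.+1) && (m.+1 <= n)
     then size (regular_parts m.+1 (n - m.+1)) else 0))%N.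
Proof.
set T := if _ then _ else _.
have -> : T = size (if ~~ (l %| m.+1)%N && (m.+1 <= n)%N
    then map (cons m.+1) (regular_parts m.+1 (n - m.+1)) else [::]).
  by rewrite /T; case: ifP => // _; rewrite size_map.
rewrite -size_cat; apply: perm_size; apply: uniq_perm.
- exact: regular_parts_uniq.
- rewrite cat_uniq regular_parts_uniq /=; apply/andP; split; last first.
    by case: ifP => // _; rewrite map_inj_uniq ?regular_parts_uniq // => ? ? [].
  case: ifP => // _; apply/hasPn => _ /mapP[s _ ->]; rewrite mem_regular_parts.
  by rewrite /= ltnn !andbF.
move=> s; rewrite mem_cat !mem_regular_parts; apply/idP/orP.
  case/and3P; case: s => [|x s]; first by move=> -> _ _; left.
  move=> px rx /= /andP[lex les].
  case: (ltngtP x m.+1) lex => // [ltx _ | ex _].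
    left; move: rx; rewrite px /is_regular /= => -> /=; rewrite -ltnS ltx /=.
    move: px => /and3P[/= sx _ _].
    have := order_path_min (rev_trans leq_trans) sx.
    by apply: sub_all => z /=; lia.
  right; move: px rx; rewrite ex /is_regular => /and3P[sx /= s0 /eqP sn] /andP[nl rs].
  rewrite nl /= ifT; last by lia.
  apply/mapP; exists s => //; rewrite mem_regular_parts /is_regular rs les !andbT.
  by rewrite /is_partition s0 (path_sorted sx) /=; apply/eqP; lia.
case; first by case/and3P=> -> -> les /=; apply: sub_all les => z /=; lia.
case: ifP => // /andP[nl lemn] /mapP[t + ->]; rewrite mem_regular_parts.
case/and3P=> /and3P[st t0 /eqP tn] rt let_.
rewrite /is_partition /= nl rt t0 leqnn let_ !andbT; apply/andP; split; last by apply/eqP; lia.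
by rewrite path_min_sorted // => //; apply: sub_all let_ => z /=.
Qed.

Section GenFun.
Variable R : comNzRingType.
Local Notation q := (fX R).

Definition regular_gf : fps R := Fps (fun n => (b l n)%:R).
Definition regular_part_gf m : fps R := Fps (fun n => (size (regular_parts m n))%:R).

Lemma regular_part_gfS m : regular_part_gf m = regular_part_gf m.+1
  * (if (l %| m.+1)%N then 1 else 1 - q ^+ m.+1).
Proof.
apply: fpsP => n; case: ifP => dvl; rewrite ?mulr1.
  by rewrite /= regular_partsS dvl addn0.
rewrite mulrC mulrBl mul1r fpsBE fXnM /= regular_partsS dvl /= natrD.
by rewrite ltnS; case: (leqP n m) => _; rewrite ?mulr0n ?addr0 ?subr0 ?addrK.
Qed.

Lemma regular_part_gfE m : regular_part_gf m * euler_part R m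
  = \prod_(i < m) (if (l %| i.+1)%N then 1 - q ^+ i.+1 else 1).
Proof.
elim: m => [|m IHm].
  rewrite /euler_part !big_ord0 mulr1; apply: fpsP => n.
  by rewrite /= regular_parts0.
rewrite euler_partS big_ord_recr /= -IHm (regular_part_gfS m).
by case: ifP => _; ring.
Qed.

Lemma prod_multiples k :
  \prod_(i < l * k) (if (l %| i.+1)%N then 1 - q ^+ i.+1 else 1) = V l (euler_part R k).
Proof.
case: l l_gt0 => // d _.
elim: k => [|k IHk]; first by rewrite muln0 /euler_part !big_ord0 rmorph1.
rewrite euler_partS rmorphM /= -IHk rmorphB rmorph1 rmorphXn /= VX // -exprM.
rewrite mulnS addnC big_split_ord /=; congr (_ * _).
rewrite big_ord_recr /= big1 ?mul1r => [|i _].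
  by rewrite -addnS dvdn_addr ?dvdn_mulr // dvdnn.
by rewrite ifF // -addnS dvdn_addr ?dvdn_mulr // gtnNdvd // ltnS.
Qed.

Lemma regular_gf_euler : regular_gf * euler R = V l (euler R).
Proof.
apply: eqt_fps => n i lein.
have len : (n <= l * n)%N by rewrite leq_pmull.
(* With the bound [l * n] on the parts, the numerator has exactly [n] factors, one for each multiple
   of [l]. *)
transitivity ((regular_part_gf (l * n) * euler_part R (l * n)) i).
  apply: (@eqtM _ n) => //; last exact: euler_trunc.
  by move=> j lejn /=; rewrite regular_parts_widen // (leq_trans lejn).
rewrite regular_part_gfE prod_multiples; symmetry.
by apply: (@eqt_V _ n) => //; apply: euler_trunc.
Qed.

End GenFun.
End Partitions.

(** * Reduction modulo 17 and the congruences *)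

Lemma fps_F17_char : (17%:R : fps 'F_17) = 0.
Proof.
rewrite -(rmorph_nat (@fC 'F_17)) (_ : 17%:R = 0 :> 'F_17) ?rmorph0 //.
exact: val_inj.
Qed.

(** Frobenius is additive in characteristic 17, so (1 - q^m)^17 = 1 - q^(17 m) in each factor of the
    partial products. *)
Lemma euler_frobenius : V 17 (euler 'F_17) = euler 'F_17 ^+ 17.
Proof.
have ch : 17%N \in [pchar (fps 'F_17)].
  by rewrite inE /=; apply/eqP; apply: fps_F17_char.
apply: eqt_fps => n i lein.
transitivity ((euler_part 'F_17 n ^+ 17) i); last first.
  by symmetry; apply: (eqt_exp 17 (euler_trunc 'F_17 (leqnn n))).
rewrite (@eqt_V _ n _ _ _ (euler_trunc 'F_17 (leqnn n))) //; congr (fcoef _ i).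
rewrite /euler_part rmorph_prod -prodrXl; apply: eq_bigr => j _.
rewrite rmorphB rmorph1 rmorphXn /= VX //.
rewrite -[RHS](pFrobenius_autE ch) rmorphB rmorph1 /= pFrobenius_autE -!exprM.
by rewrite mulnC.
Qed.

Lemma regular17_gf : regular_gf 17 'F_17 = euler 'F_17 ^+ 16.
Proof.
apply: (fps_unit_lreg (euler0 'F_17)).
by rewrite mulrC regular_gf_euler // euler_frobenius -exprS.
Qed.

Lemma natr_F17 (m n : nat) : (m%:R = n%:R :> 'F_17)%R -> m = n %[mod 17].
Proof. by move=> /(congr1 val); rewrite /= !(@val_Fp_nat 17). Qed.

Lemma b17_three_steps n : (b 17 (125 * n + 41))%:R
  = if (n < 3)%N then 0 else if (5 %| n - 3)%N then (2 * b 17 ((n - 3) %/ 5))%:R else 0 :> 'F_17.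
Proof.
(* The operators compose to 5 (5 (5 n + 1) + 3) + 1 = 125 n + 41. *)
have -> : (b 17 (125 * n + 41))%:R = Uc 1 (Uc 3 (Uc 1 (regular_gf 17 'F_17))) n.
  by rewrite /regular_gf /Uc; congr ((b 17 _)%:R); lia.
have -> : Uc 1 (Uc 3 (Uc 1 (regular_gf 17 'F_17)))
    = fC 2%:R * (fX 'F_17 ^+ 3 * V 5 (regular_gf 17 'F_17)).
  by rewrite regular17_gf (three_steps fps_F17_char) rmorphXn /= rmorph_nat mulrA.
rewrite fCM fXnM; case: ifP => _; first by rewrite mulr0.
rewrite /V /regular_gf; case: ifP => dv; last by rewrite /= dv mulr0.
by rewrite natrM /= dv.
Qed.

Lemma b17_625 n : b 17 (625 * n + 416) = 2 * b 17 n %[mod 17].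
Proof.
apply: natr_F17; rewrite (_ : 625 * n + 416 = 125 * (5 * n + 3) + 41)%N; last by lia.
by rewrite b17_three_steps ltnNge leq_addl addnK dvdn_mulr // mulKn.
Qed.

Lemma exp5_mod3 k : (5 ^ (4 * k) %% 3 = 1)%N.
Proof. by rewrite expnM -modnXm exp1n. Qed.

Lemma b17_iter k n :
  b 17 (5 ^ (4 * k) * n + (2 * (5 ^ (4 * k) - 1)) %/ 3) = 2 ^ k * b 17 n %[mod 17].
Proof.
elim: k => [|k IHk]; first by rewrite expn0 !mul1n subnn div0n addn0.
have := exp5_mod3 k; move: IHk; rewrite mulnS expnD [(2 ^ k.+1)%N]expnS.
move: (5 ^ (4 * k))%N => p IHk p1.
(* The division by 3 is exact because p = 1 modulo 3, and the shifts satisfy c' = 625 c + 416. *)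
have -> : (5 ^ 4 * p * n + (2 * (5 ^ 4 * p - 1)) %/ 3
  = 625 * (p * n + (2 * (p - 1)) %/ 3) + 416)%N.
  by rewrite -mulnA; move: (p * n)%N => x; lia.
by rewrite b17_625 -modnMmr IHk modnMmr mulnA.
Qed.

Lemma b17_125_vanish r n : r \in [:: 0; 1; 2; 4]%N ->
  b 17 (125 * (5 * n + r) + 41) = 0 %[mod 17].
Proof.
move=> rP; apply: natr_F17; rewrite b17_three_steps.
case: ltnP => // le3; rewrite ifF //.
by move: rP le3; rewrite !inE => /or4P[] /eqP ->; lia.
Qed.

Local Close Scope ring_scope.

Theorem theorem1p2 :
  (forall n k : nat,
      b 17 (5 ^ (4 * k) * n + (2 * (5 ^ (4 * k) - 1)) %/ 3)
      = 2 ^ k * b 17 n %[mod 17])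
  /\
  (forall r : nat, r \in [:: 0; 1; 2; 4] -> forall n k : nat,
      b 17 (5 ^ (4 * k + 4) * n + (5 ^ (4 * k + 3) * (3 * r + 1) - 2) %/ 3)
      = 0 %[mod 17]).
Proof.
split=> [n k | r rP n k]; first exact: b17_iter.
have p1 := exp5_mod3 k.
(* The second family is the first one evaluated at 125 (5 n + r) + 41, where the coefficient already
   vanishes. *)
have -> : 5 ^ (4 * k + 4) * n + (5 ^ (4 * k + 3) * (3 * r + 1) - 2) %/ 3
    = 5 ^ (4 * k) * (125 * (5 * n + r) + 41) + (2 * (5 ^ (4 * k) - 1)) %/ 3.
  rewrite !expnD; move: (5 ^ (4 * k)) p1 => p p1.
  by rewrite (_ : 5 ^ 4 = 625) // (_ : 5 ^ 3 = 125) //; lia.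
by rewrite b17_iter -modnMmr b17_125_vanish // mod0n muln0.
Qed.
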